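(* Let $f,f'\in\omega^\omega$ be increasing. If $f(n+1)-f(n)\leq f'(n+1)-f'(n)$ for all but finitely many $n<\omega$, then $\mathrm{add}(\mathcal{I}_f)\geq\mathrm{add}(\mathcal{I}_{f'})$ and $\mathrm{cof}(\mathcal{I}_f)\leq\mathrm{cof}(\mathcal{I}_{f'})$. In particular, $\mathrm{add}(\mathcal{I}_f)\leq\mathrm{add}(\mathcal{I}_{\mathrm{id}_\omega})$ and $\mathrm{cof}(\mathcal{I}_{\mathrm{id}_\omega})\leq\mathrm{cof}(\mathcal{I}_f)$.
   Context: Yorioka ideals: for $\sigma\in(2^{<\omega})^\omega$, $[\sigma]_\infty=\{x\in2^\omega:\exists^\infty n\,(\sigma(n)\subseteq x)\}$, $h_\sigma(i)=|\sigma(i)|$; $f\ll g$ iff $\forall k\,\forall^\infty n\,(f(n^k)\leq g(n))$; $\mathcal{J}_g=\{X\subseteq2^\omega:\exists\sigma\,(X\subseteq[\sigma]_\infty,\ h_\sigma=g)\}$; $\mathcal{I}_f=\bigcup_{g\gg f}\mathcal{J}_g$. $\mathrm{add}$ and $\mathrm{cof}$ denote additivity and cofinality of an ideal. *)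

(* Defs.v *)
From mathcomp Require Import all_boot.
From mathcomp Require Import boolp classical_sets functions cardinality filter.

Set Implicit Arguments.
Unset Strict Implicit.
Unset Printing Implicit Defensive.

Local Open Scope classical_set_scope.
Local Open Scope card_scope.

(* The cardinal min {|A| : A in W}, represented by a chosen A in W of least
   cardinality; such cardinals are compared with #<=.  The default set0 is
   returned only when W is empty (see least_cardP). *)
Definition least_card (T : Type) (W : set (set T)) : set T :=
  xget set0 [set A | W A /\ forall B, W B -> A #<= B].

Definition add (T : Type) (I : set (set T)) : set (set T) :=
  least_card [set F | F `<=` I /\ ~ I (\bigcup_(X in F) X)].

Definition cof (T : Type) (I : set (set T)) : set (set T) :=
  least_card [set F | F `<=` I /\
    forall X, I X -> exists2 Y, F Y & X `<=` Y].

Definition increasing (f : nat -> nat) : Prop := {homo f : m n / m < n}.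

Definition extends (x : nat -> bool) (s : seq bool) : Prop :=
  forall i, i < size s -> x i = nth false s i.

Definition limsup_set (sigma : nat -> seq bool) : set (nat -> bool) :=
  [set x | infinite_set [set n | extends x (sigma n)]].

Definition height (sigma : nat -> seq bool) : nat -> nat :=
  fun i => size (sigma i).

Definition dominated (f g : nat -> nat) : Prop :=
  forall k, \forall n \near \oo, f (n ^ k) <= g n.

Definition Jset (g : nat -> nat) : set (set (nat -> bool)) :=
  [set X | exists2 sigma, X `<=` limsup_set sigma & height sigma = g].

Definition Yorioka (f : nat -> nat) : set (set (nat -> bool)) :=
  \bigcup_(g in [set g | dominated f g]) Jset g.

Lemma least_card_ex (T : pointedType) (W : set (set T)) : W !=set0 ->
  exists A, W A /\ forall B, W B -> A #<= B.
Proof.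
move=> [A0 WA0].
pose P (S : set (set T -> T)) :=
  (forall s A, S s -> W A -> A (s A)) /\
  (forall s t A, S s -> S t -> W A -> s A = t A -> s = t).
have [|S [[S1 S2] Smax]] := @Zorn_bigcup _ P.
  move=> F FP Ftot; split=> [s A [X FX Xs] WA|s t A [X FX Xs] [Y FY Yt] WA].
    by have [P1 _] := FP _ FX; exact: P1 Xs WA.
  have [XY|YX] := Ftot _ _ FX FY.
    by have [_ P2] := FP _ FY; exact: (P2 s t A (XY _ Xs) Yt WA).
  by have [_ P2] := FP _ FX; exact: (P2 s t A Xs (YX _ Yt) WA).
have [A WA Asurj] : exists2 A, W A & forall a, A a -> exists2 s, S s & s A = a.
  apply: contrapT => nA.
  have /choice[s0 Hs0] : forall A, exists a, W A ->
      A a /\ forall s, S s -> s A <> a.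
    move=> A; have [WA|nWA] := pselect (W A); last by exists point.
    apply: contrapT => H; apply: nA; exists A => // a Aa.
    apply: contrapT => H'; apply: H; exists a => _; split=> // s Ss sAa.
    by apply: H'; exists s.
  apply: (Smax (S `|` [set s0])).
    split=> [|sub]; first by move=> s Ss; left.
    have /sub Ss0 : (S `|` [set s0]) s0 by right.
    by have [_ /(_ _ Ss0)] := Hs0 _ WA0.
  split=> [s A [Ss|->] WA|s t A [Ss|->] [St|->] WA //].
  - exact: (S1 s A Ss WA).
  - by have [] := Hs0 _ WA.
  - exact: (S2 s t A Ss St WA).
  - by have [_ /(_ _ Ss)] := Hs0 _ WA.
  - by have [_ /(_ _ St)] := Hs0 _ WA => + /esym.
exists A; split=> // B WB.
apply/pcard_surjP; exists (fun b => get [set a | exists2 s, S s & s A = a /\ s B = b]).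
move=> a /Asurj[s Ss sAa]; exists (s B); first exact: (S1 s B Ss WB).
apply: get_unique; first by exists s.
by move=> a' [t St [<-]] /(S2 _ _ _ St Ss WB) ->.
Qed.

Lemma least_cardP (T : pointedType) (W : set (set T)) : W !=set0 ->
  W (least_card W) /\ forall B, W B -> least_card W #<= B.
Proof. by move=> /least_card_ex; exact: xgetPex. Qed.

Lemma increasing_ge (f : nat -> nat) n : increasing f -> n <= f n.
Proof. by move=> fi; elim: n => // n /leq_ltn_trans; apply; exact: fi. Qed.

Lemma Yorioka_proper (f : nat -> nat) : increasing f -> ~ Yorioka f [set: nat -> bool].
Proof.
move=> fi [g /= fg [s sub hs]].
have [N _ HN] := fg 2.
have /sub : [set: nat -> bool] (fun n => ~~ nth false (s n) n) by [].
apply; apply: (sub_finite_set _ (finite_II (maxn N 2))) => n /= ext.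
rewrite ltnNge; apply/negP; rewrite geq_max => /andP[Nn n2].
have ng : n < size (s n).
  have -> : size (s n) = g n by rewrite -hs.
  apply: leq_trans (HN n Nn); apply: leq_trans (increasing_ge _ fi).
  by rewrite -mulnn ltn_Pmulr // (leq_trans _ n2).
by have := ext n ng; case: nth.
Qed.

Lemma Yorioka_set1 (f : nat -> nat) x : increasing f -> Yorioka f [set x].
Proof.
move=> fi; exists (fun n => f (n ^ n)) => /=.
  move=> k; exists k.+1 => // n /= kn.
  have fm : {homo f : m n / m <= n}.
    by move=> a b; rewrite leq_eqVlt => /predU1P[->//|/fi/ltnW].
  by apply: fm; apply: leq_pexp2l; [exact: leq_trans kn|exact: ltnW].
exists (fun n => mkseq x (f (n ^ n))); last first.
  by apply/funext => n; rewrite /height size_mkseq.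
move=> _ ->; rewrite /limsup_set /=.
rewrite (_ : [set _ | _] = setT); first exact: infinite_nat.
apply/seteqP; split=> // n _ i; rewrite size_mkseq => ilt.
by rewrite nth_mkseq.
Qed.

Lemma add_YoriokaP (f : nat -> nat) : increasing f ->
  let W := [set F | F `<=` Yorioka f /\ ~ Yorioka f (\bigcup_(X in F) X)] in
  W (add (Yorioka f)) /\ forall F, W F -> add (Yorioka f) #<= F.
Proof.
move=> fi W; apply: least_cardP; exists (Yorioka f); split=> //.
rewrite (_ : \bigcup_(X in _) X = setT); first exact: Yorioka_proper.
by apply/seteqP; split=> // x _; exists [set x] => //; exact: Yorioka_set1.
Qed.

Lemma cofP (T : Type) (I : set (set T)) :
  let W := [set F | F `<=` I /\ forall X, I X -> exists2 Y, F Y & X `<=` Y] in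
  W (cof I) /\ forall F, W F -> cof I #<= F.
Proof. by move=> W; apply: least_cardP; exists I; split=> // X IX; exists X. Qed.

(* Main.v *)
(** Suppose that the increments of [f] are bounded by those of [f'] from [N] on.
    Then the blocks [f n, f n.+1) of positions embed, in order, into the blocks
    [f' n, f' n.+1) shifted by [f N]; call [e] this embedding of [nat] in itself
    and let [spread x] carry the bit [x i] at position [e i] and [false] elsewhere.
    Prefixes of [x] of length about [f m] correspond to prefixes of [spread x] of
    length about [f' m], and the constant error is absorbed by passing from
    [n ^ k] to [n ^ k.+1].  Hence direct images under [spread] send [Yorioka f]
    into [Yorioka f'] and preimages send [Yorioka f'] into [Yorioka f]; this
    Tukey connection gives both cardinal inequalities.  Since increasing
    functions have increments at least [1], it applies to [id] and any [f]. *)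
Require Import Defs.
From mathcomp Require Import all_boot.
From mathcomp Require Import boolp classical_sets functions cardinality filter.
From mathcomp Require Import zify.

Set Implicit Arguments.
Unset Strict Implicit.
Unset Printing Implicit Defensive.

Local Open Scope classical_set_scope.
Local Open Scope card_scope.

Section Tukey.
Variables (T U : Type) (I : set (set T)) (J : set (set U)) (h : T -> U).
Hypothesis I_sub : forall X Y, X `<=` Y -> I Y -> I X.
Hypothesis image_J : forall X, I X -> J (h @` X).
Hypothesis preimage_I : forall Y, J Y -> I (h @^-1` Y).

(** If the union of the images were in [J], its preimage would be in [I] and would contain the
    original union; so images of a witness for [add I] form one for [add J]. The premise keeps both
    minima from ranging over the empty set. *)
Lemma add_le_Tukey :
  (exists2 F, F `<=` I & ~ I (\bigcup_(X in F) X)) -> add J #<= add I.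
Proof.
move=> [F0 F0I nF0].
have imJ F : F `<=` I -> ~ I (\bigcup_(X in F) X) ->
    (image F (image^~ h)) `<=` J /\ ~ J (\bigcup_(Y in image F (image^~ h)) Y).
  move=> FI nF; split=> [_ [X FX <-]|/preimage_I]; first exact/image_J/FI.
  move=> /I_sub IU; apply/nF/IU => x [X FX Xx].
  by exists (h @` X); [exists X|exists x].
have [[addI naddI] _] := @least_cardP _
  [set F | F `<=` I /\ ~ I (\bigcup_(X in F) X)] (ex_intro _ F0 (conj F0I nF0)).
have [_ addJ] := @least_cardP _
  [set F | F `<=` J /\ ~ J (\bigcup_(X in F) X)]
  (ex_intro _ _ (imJ _ F0I nF0)).
exact: card_le_trans (addJ _ (imJ _ addI naddI)) (card_image_le _ _).
Qed.

(** Preimages of a family cofinal in [J] are cofinal in [I]. *)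
Lemma cof_le_Tukey : cof I #<= cof J.
Proof.
have [_ cofI] := cofP I; have [[cofJ cofJP] _] := cofP J.
apply: card_le_trans (card_image_le (preimage h) (cof J)).
apply: cofI; split=> [_ [Y CY <-]|X /image_J/cofJP[Y CY XY]].
  exact/preimage_I/cofJ.
by exists (h @^-1` Y); [exists Y|move=> x Xx; apply: XY; exists x].
Qed.

End Tukey.

Lemma Yorioka_sub (f : nat -> nat) (X Y : set (nat -> bool)) :
  X `<=` Y -> Yorioka f Y -> Yorioka f X.
Proof. by move=> XY [g fg [s Ys hs]]; exists g => //; exists s => // x /XY/Ys. Qed.

Lemma increasing_leq (f : nat -> nat) : increasing f -> {homo f : m n / m <= n}.
Proof. by move=> fi m n; rewrite leq_eqVlt => /predU1P[->//|/fi/ltnW]. Qed.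

Lemma increasing_leq_mono (f : nat -> nat) :
  increasing f -> {mono f : m n / m <= n}.
Proof.
move=> fi m n; apply/idP/idP; last exact: increasing_leq.
by apply: contraTT; rewrite -!ltnNge; exact: fi.
Qed.

Lemma increasing_addn (f : nat -> nat) m n : increasing f -> f m + n <= f (m + n).
Proof.
move=> fi; elim: n => [|n IH]; first by rewrite !addn0.
by rewrite !addnS; apply: leq_ltn_trans IH _; exact: fi.
Qed.

Section Spread.
Variable e : nat -> nat.
Hypothesis e_incr : increasing e.

Definition spread (x : nat -> bool) (j : nat) : bool :=
  `[< exists2 i, e i = j & x i >].

Lemma spreadE x i : spread x (e i) = x i.
Proof.
apply/asboolP/idP => [[i' /eqP]|xi]; last by exists i.
by rewrite eqn_leq !increasing_leq_mono // -eqn_leq => /eqP ->.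
Qed.

(** [l L] counts the bits of [x] that [spread x] carries below position [L]. *)
Lemma increasing_lower_inv : exists l, forall L i, (i < l L) = (e i < L).
Proof.
suff /choice[l lP] : forall L, exists l, forall i, (i < l) = (e i < L).
  by exists l.
move=> L; have exL : exists i, L <= e i by exists L; exact: increasing_ge.
case: (ex_minnP exL) => m Lm minm; exists m => i; apply/idP/idP.
  by rewrite !ltnNge; apply: contra => /minm.
rewrite !ltnNge; apply: contra => mi; apply: leq_trans Lm _.
by rewrite increasing_leq_mono.
Qed.

Variables f f' : nat -> nat.
Hypothesis f_incr : increasing f.
Hypothesis f'_incr : increasing f'.

Lemma spread_image N : (forall m, N <= m -> f' m <= e (f m)) ->
  forall X, Yorioka f X -> Yorioka f' (spread @` X).
Proof.
move=> ef X [g fg [s Xs hs]]; exists (e \o g).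
  (* The extra factor [n] ensures [N <= n ^ k.+1], even for [k = 0]. *)
  move=> k; have [M _ HM] := fg k.+1; exists (maxn M N.+1) => // n /=.
  rewrite geq_max => /andP[Mn Nn].
  have n0 : 0 < n by exact: leq_trans Nn.
  apply: (@leq_trans (f' (n ^ k.+1))).
    by rewrite increasing_leq_mono // leq_pexp2l.
  apply: leq_trans (ef _ _) _.
    by apply: (leq_trans (ltnW Nn)); rewrite expnS leq_pmulr // expn_gt0 n0.
  by rewrite increasing_leq_mono //; exact: HM.
(* Padding [s n] with [false] is harmless: below [e (size (s n))], [spread] reads only positions
   [i < size (s n)]. *)
exists (fun n => mkseq (spread (nth false (s n))) (e (size (s n)))); last first.
  by apply/funext => n; rewrite /height size_mkseq /= -hs.
move=> _ [x /Xs + <-]; apply: sub_infinite_set => n xs j.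
rewrite size_mkseq => jlt; rewrite nth_mkseq //.
have lts i : e i = j -> i < size (s n).
  by move=> eij; rewrite ltnNge -(increasing_leq_mono e_incr) -ltnNge eij.
by apply/asboolP/asboolP => -[i eij xi]; exists i => //;
  move: xi; rewrite (xs i (lts i eij)).
Qed.

Lemma spread_preimage N c :
  (forall m i, N <= m -> i < f m -> e i < f' (m + c)) ->
  forall Y, Yorioka f' Y -> Yorioka f (spread @^-1` Y).
Proof.
move=> ef Y [g fg [t Yt ht]]; have [l lP] := increasing_lower_inv.
exists (l \o g).
  (* One extra factor [n] gives [N <= n ^ k.+1], the other absorbs [c]: [n ^ k.+1 + c <= n ^ k.+2]
     since [c < n]. *)
  move=> k; have [M _ HM] := fg k.+2; exists (maxn M (maxn N c).+1) => // n /=.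
  rewrite geq_max => /andP[Mn]; rewrite gtn_max => /andP[Nn cn].
  have n0 : 0 < n by exact: leq_trans Nn.
  apply: (@leq_trans (f (n ^ k.+1))).
    by rewrite increasing_leq_mono // leq_pexp2l.
  have Nk : N <= n ^ k.+1.
    by apply: (leq_trans (ltnW Nn)); rewrite expnS leq_pmulr // expn_gt0 n0.
  case E : (f _) => [//|i]; rewrite lP.
  apply: leq_trans (ef _ i Nk _) _; first by rewrite E.
  apply: leq_trans (HM _ Mn); rewrite increasing_leq_mono //.
  have : 0 < n ^ k.+1 by rewrite expn_gt0 n0.
  by rewrite [n ^ k.+2]expnSr; nia.
exists (fun n => mkseq (fun i => nth false (t n) (e i)) (l (size (t n)))); last first.
  by apply/funext => n; rewrite /height size_mkseq /= -ht.
move=> x /Yt; apply: sub_infinite_set => n xt i /=.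
rewrite size_mkseq => il; rewrite nth_mkseq // -xt ?spreadE //.
by rewrite -lP.
Qed.

End Spread.

Section BlockEmbedding.
Variables (f f' : nat -> nat) (N : nat).
Hypothesis f_incr : increasing f.
Hypothesis f'_incr : increasing f'.
Hypothesis ff' : forall n, N <= n -> f n.+1 - f n <= f' n.+1 - f' n.

(* The shift by [f N] keeps the truncated subtraction exact and leaves room
   for the first [f N] positions. *)
Definition offset n := f' n + f N - f n.

(** Since [offset] is nondecreasing from [N] on, the maximum is the offset of the block of [f]
    containing [i]; it is empty, hence [0], when [i < f N]. The bound [n < i.+1] loses nothing
    because [n <= f n]. *)
Definition block_embedding i :=
  i + \max_(n < i.+1 | (N <= n) && (f n <= i)) offset n.

Lemma offsetK m : N <= m -> f m + offset m = f' m + f N.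
Proof.
move=> Nm; apply: subnKC; rewrite -(subnKC Nm).
elim: (m - N) => [|k IH]; first by rewrite addn0 leq_addl.
have := ff' (leq_addr k N); have := f_incr (ltnSn (N + k)).
by have := f'_incr (ltnSn (N + k)); rewrite addnS; lia.
Qed.

(** Each increment of [offset] is the excess of the increment of [f'] over that of [f]. *)
Lemma offset_homo m n : N <= m -> m <= n -> offset m <= offset n.
Proof.
move=> Nm mn; rewrite -(subnKC mn); elim: (n - m) => [|k IH]; first by rewrite addn0.
apply: leq_trans IH _; have Nk : N <= m + k by exact: leq_trans (leq_addr _ _).
have := offsetK Nk; have := offsetK (leqW Nk); have := ff' Nk.
have := f_incr (ltnSn (m + k)); have := f'_incr (ltnSn (m + k)).
by rewrite addnS; lia.
Qed.

Lemma block_embedding_incr : increasing block_embedding.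
Proof.
move=> i j ij; rewrite -addSn; apply: leq_add => //.
apply/bigmax_leqP => n /andP[Nn fn].
have nj : n < j.+1 by rewrite (leq_trans (ltn_ord n)) // ltnW.
by apply: (leq_bigmax_cond (Ordinal nj)); rewrite /= Nn (leq_trans fn) // ltnW.
Qed.

Lemma block_embedding_ge m : N <= m -> f' m <= block_embedding (f m).
Proof.
move=> Nm; have mf : m < (f m).+1 by rewrite ltnS increasing_ge.
apply: (@leq_trans (f m + offset m)); first by rewrite offsetK // leq_addr.
rewrite leq_add2l; apply: (leq_bigmax_cond (Ordinal mf)).
by rewrite /= Nm leqnn.
Qed.

(** Blocks starting at or before [i] have index below [m], so their offsets are at most [offset m];
    the shift [f N] moves inside [f'], which grows by at least [1] per step. *)
Lemma block_embedding_lt m i :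
  N <= m -> i < f m -> block_embedding i < f' (m + f N).
Proof.
move=> Nm im; apply: leq_trans (increasing_addn _ _ f'_incr).
rewrite -offsetK // -addSn; apply: leq_add => //.
apply/bigmax_leqP => n /andP[Nn fn]; apply: offset_homo => //.
by rewrite -(increasing_leq_mono f_incr) (leq_trans fn) // ltnW.
Qed.

End BlockEmbedding.

Lemma Yorioka_add_cof_le (f f' : nat -> nat) :
  increasing f -> increasing f' ->
  (\forall n \near \oo, f n.+1 - f n <= f' n.+1 - f' n) ->
  add (Yorioka f') #<= add (Yorioka f) /\ cof (Yorioka f) #<= cof (Yorioka f').
Proof.
move=> fi f'i [N _ ff'].
have ei := block_embedding_incr f f' N.
have im := spread_image ei f'i (block_embedding_ge fi f'i ff').
have pre := spread_preimage ei fi f'i (block_embedding_lt fi f'i ff').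
split; last exact: cof_le_Tukey im pre.
apply: add_le_Tukey (@Yorioka_sub f) im pre _.
by have [[FI nF] _] := add_YoriokaP fi; exists (add (Yorioka f)).
Qed.

Theorem theorem3p14 (f f' : nat -> nat)
    (f_incr : increasing f) (f'_incr : increasing f') :
  ((\forall n \near \oo, f n.+1 - f n <= f' n.+1 - f' n) ->
     add (Yorioka f') #<= add (Yorioka f) /\
     cof (Yorioka f) #<= cof (Yorioka f')) /\
  (add (Yorioka f) #<= add (Yorioka id) /\
   cof (Yorioka id) #<= cof (Yorioka f)).
Proof.
split; first exact: Yorioka_add_cof_le.
apply: Yorioka_add_cof_le => //; exists 0 => // n _ /=.
by rewrite subSnn subn_gt0; exact: f_incr.
Qed.
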